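(* Let $S$ be a posemigroup and let $\tau\colon S\to\mathscr Q(S)$ be given by $\tau(s)=s{\downarrow}$ for $s\in S$. Then $\tau$ is a full reflection of $S$ in the category of quantales, as a subcategory of $\mathsf{PoSgr}^-$. That is: (i) $\tau$ is a morphism of $\mathsf{PoSgr}^-$, and for every quantale $Q$ and every $\mathsf{PoSgr}^-$-morphism $f\colon S\to Q$ there exists a unique quantale morphism $g\colon\mathscr Q(S)\to Q$ such that $g\circ\tau=f$; (ii) the category of quantales is a full subcategory of $\mathsf{PoSgr}^-$, i.e. the $\mathsf{PoSgr}^-$-morphisms between two quantales are exactly the quantale morphisms between them. Moreover, if $Q$ is a quantale and $f\colon S\to Q$ is a $\mathsf{PoSgr}^-$-morphism that is an order-embedding, then the quantale morphism $g\colon\mathscr Q(S)\to Q$ with $f=g\circ\tau$ is also an order-embedding.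
   Context: A posemigroup is a semigroup with a partial order $\leqslant$ compatible with multiplication in both arguments; posemigroup morphisms are the monotone multiplicative maps. $S^1$ denotes $S$ if $S$ has an identity element, and otherwise $S$ with an identity $1$ adjoined. A quantale is a posemigroup that is a complete lattice in which multiplication distributes over arbitrary joins in both arguments; quantale morphisms preserve multiplication and arbitrary joins. An order-embedding is a map $f$ between posets with $x\leqslant y\iff f(x)\leqslant f(y)$. For $X\subseteq S$, $X{\downarrow}=\{p\in S\mid p\leqslant x\text{ for some }x\in X\}$, and $s{\downarrow}=\{s\}{\downarrow}$. A lower subset is an $X\subseteq S$ with $X{\downarrow}=X$ ($\emptyset$ included). For a lower subset $D$ of a posemigroup $S$, its closure is $$\overline D=\{x\in S\mid \text{for all } a\in S,\ b,c\in S^1:\ bDc\subseteq a{\downarrow}\Rightarrow bxc\leqslant a\}.$$ $D$ is closed if $\overline D=D$. $\mathscr Q(S)$ is the set of all closed lower subsets of $S$, ordered by inclusion. It is a quantale with multiplication $A\cdot B=\overline{\{ab\mid a\in A,b\in B\}{\downarrow}}$ and joins $\bigvee_i D_i=\overline{\bigcup_i D_i}$. A posemigroup morphism $f\colon S\to T$ is closure preserving if $f(\overline{M{\downarrow}})\subseteq\overline{f(M){\downarrow}}$ for every $M\subseteq S$. $\mathsf{PoSgr}^-$ is the category whose objects are posemigroups and whose morphisms are the closure preserving posemigroup morphisms. *)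

(* Defs.v *)
From HB Require Import structures.
From mathcomp Require Import all_boot all_order.
From mathcomp Require Import boolp classical_sets.

Set Implicit Arguments.
Unset Strict Implicit.
Unset Printing Implicit Defensive.

Import Order.TTheory.
Local Open Scope classical_set_scope.
Local Open Scope order_scope.
Local Open Scope group_scope.

(* The carrier is a choiceType with a boolean order, as everywhere in
   MathComp; classically (boolp) this is no restriction on a poset. *)
HB.mixin Record isPoSemigroup d T of Order.POrder d T & Semigroup T := {
  le_mulgl : forall z x y : T, (x <= y)%O -> (z * x <= z * y)%O;
  le_mulgr : forall z x y : T, (x <= y)%O -> (x * z <= y * z)%O
}.

#[short(type="poSemigroupType")]
HB.structure Definition PoSemigroup d :=
  {T of Order.POrder d T & Semigroup T & isPoSemigroup d T}.

HB.mixin Record isQuantale d T of PoSemigroup d T := {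
  qsup : set T -> T;
  qsup_isLub : forall A : set T, isLub A (qsup A);
  mulg_qsupr : forall (x : T) (A : set T), x * qsup A = qsup [set x * y | y in A];
  mulg_qsupl : forall (A : set T) (x : T), qsup A * x = qsup [set y * x | y in A]
}.

#[short(type="quantaleType")]
HB.structure Definition Quantale d := {T of PoSemigroup d T & isQuantale d T}.

Definition posemigroup_morphism d (S : poSemigroupType d)
    d' (T : poSemigroupType d') (f : S -> T) : Prop :=
  {homo f : x y / (x <= y)%O} /\ {morph f : x y / x * y}.

Definition quantale_morphism d (P : quantaleType d) d' (Q : quantaleType d')
    (f : P -> Q) : Prop :=
  {morph f : x y / x * y} /\ forall A : set P, f (qsup A) = qsup (f @` A).

Definition order_embedding d (S : porderType d) d' (T : porderType d')
    (f : S -> T) : Prop := {mono f : x y / (x <= y)%O}.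

Section Closure.
Context {d : Order.disp_t} {S : poSemigroupType d}.
Implicit Types (D X Y Z : set S) (x y a : S) (b c : option S).

Definition is_identity (e : S) : Prop := forall x, e * x = x /\ x * e = x.

(* S^1, with None as the adjoined identity: it belongs to S^1 only when S has
   no identity of its own.  Only the products b * x * c with x in S occur, so
   S^1 is given through its left and right actions on S. *)
Definition S1 : set (option S) :=
  [set b | b = None -> ~ exists e, is_identity e].

Definition lact1 b x : S := if b is Some s then s * x else x.
Definition ract1 x c : S := if c is Some s then x * s else x.

Definition pclosure D : set S :=
  [set x | forall a b c, S1 b -> S1 c ->
     [set ract1 (lact1 b y) c | y in D] `<=` down [set a] ->
     (ract1 (lact1 b x) c <= a)%O].

Definition is_lower D : Prop := down D = D.

Definition is_pclosed D : Prop := pclosure D = D.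

Lemma down1E a x : down [set a] x <-> (x <= a)%O.
Proof. by split=> [[y [-> //]]|xa]; exists a. Qed.

Lemma pclosureE D x : pclosure D x <-> forall a b c, S1 b -> S1 c ->
  (forall y, D y -> (ract1 (lact1 b y) c <= a)%O) ->
  (ract1 (lact1 b x) c <= a)%O.
Proof.
split=> H a b c hb hc Da; apply: (H a b c hb hc).
  by move=> _ [y Dy <-]; apply/down1E; exact: Da.
by move=> y Dy; apply/down1E/Da; exists y.
Qed.

Lemma le_act1 b c x y : (x <= y)%O ->
  (ract1 (lact1 b x) c <= ract1 (lact1 b y) c)%O.
Proof.
move=> xy; have : (lact1 b x <= lact1 b y)%O by case: b => //= s; exact: le_mulgl.
by case: c => //= s; exact: le_mulgr.
Qed.

Lemma subset_pclosure D : D `<=` pclosure D.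
Proof. by move=> x Dx; apply/pclosureE => a b c _ _; apply. Qed.

Lemma pclosure_sub D X : D `<=` pclosure X -> pclosure D `<=` pclosure X.
Proof.
move=> DX x /pclosureE Dx; apply/pclosureE => a b c hb hc Xa.
by apply: Dx => // y /DX/pclosureE; apply.
Qed.

Lemma pclosure_mono D X : D `<=` X -> pclosure D `<=` pclosure X.
Proof.
by move=> DX; apply: pclosure_sub; apply: subset_trans DX (@subset_pclosure _).
Qed.

Lemma pclosureK D : is_pclosed (pclosure D).
Proof. by apply/seteqP; split; [exact: pclosure_sub | exact: subset_pclosure]. Qed.

Lemma subset_down D : D `<=` down D.
Proof. by move=> x Dx; exists x. Qed.

Lemma down_pclosure D : is_lower (pclosure D).
Proof.
apply/seteqP; split; last exact: subset_down.
move=> x [y [/pclosureE Dy xy]]; apply/pclosureE => a b c hb hc Da.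
by apply: le_trans (Dy a b c hb hc Da); apply: le_act1.
Qed.

Lemma pclosure_down D : pclosure (down D) = pclosure D.
Proof.
apply/seteqP; split; last exact/pclosure_mono/subset_down.
apply: pclosure_sub => x [y [Dy xy]]; rewrite -down_pclosure.
by exists y; split=> //; exact: subset_pclosure.
Qed.

Lemma S1_unit : exists2 b, S1 b & forall x, lact1 b x = x /\ ract1 x b = x.
Proof.
have [[e eP]|n] := pselect (exists e, is_identity e).
  by exists (Some e) => // x; exact: eP.
by exists None.
Qed.

Lemma is_lower_down a : is_lower (down [set a]).
Proof.
apply/seteqP; split; last exact: subset_down.
by move=> x [y [/down1E ya xy]]; apply/down1E; exact: le_trans ya.
Qed.

Lemma is_pclosed_down a : is_pclosed (down [set a]).
Proof.
apply/seteqP; split; last exact: subset_pclosure.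
have [u hu uP] := S1_unit.
move=> x /pclosureE /(_ a u u hu hu); rewrite (uP x).1 (uP x).2 => xa.
by apply/down1E/xa => y /down1E; rewrite (uP y).1 (uP y).2.
Qed.

Lemma ract1M x y c : ract1 (x * y) c = x * ract1 y c.
Proof. by case: c => //= s; rewrite mulgA. Qed.

Lemma lact1M x y b : lact1 b (x * y) = lact1 b x * y.
Proof. by case: b => //= s; rewrite mulgA. Qed.

Lemma pclosureM X Y :
  pclosure [set x * y | x in pclosure X & y in pclosure Y] =
  pclosure [set x * y | x in X & y in Y].
Proof.
apply/seteqP; split; last first.
  by apply: pclosure_mono; apply: image2_subset; exact: subset_pclosure.
apply: pclosure_sub => _ [x /pclosureE Xx [y /pclosureE Yy <-]].
apply/pclosureE => a b c hb hc XYa.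
rewrite lact1M; apply: (Yy a (Some (lact1 b x)) c) => // y' Yy' /=.
rewrite ract1M; apply: (Xx a b (Some (ract1 y' c))) => // x' Xx' /=.
by rewrite -ract1M -lact1M; apply: XYa; exists x' => //; exists y'.
Qed.

End Closure.
Arguments S1 {d} S.

Definition is_closed_lower d (S : poSemigroupType d) : pred (set S) :=
  fun D => `[< is_lower D /\ is_pclosed D >].

Record closed_lower d (S : poSemigroupType d) := ClosedLower {
  closed_lower_set :> set S;
  closed_lowerP : is_closed_lower closed_lower_set
}.

HB.instance Definition _ d (S : poSemigroupType d) :=
  [isSub for @closed_lower_set d S].
HB.instance Definition _ d (S : poSemigroupType d) :=
  [Choice of closed_lower S by <:].
(* Inherited from the inclusion order of [set S]. *)
HB.instance Definition _ d (S : poSemigroupType d) :=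
  [SubChoice_isSubPOrder of closed_lower S by <: with set_display].

Section QuantaleOfClosedLowerSets.
Context {d : Order.disp_t} {S : poSemigroupType d}.
Implicit Types A B C : closed_lower S.

Lemma closed_lower_leE A B : (A <= B)%O = (A `<=` B) :> Prop.
Proof. exact: subsetEset. Qed.

Lemma closed_lowerK A : pclosure A = A.
Proof. by have /asboolP[] := closed_lowerP A. Qed.

Lemma closed_lower_pclosure (D : set S) : is_closed_lower (pclosure D).
Proof. by apply/asboolP; split; [exact: down_pclosure | exact: pclosureK]. Qed.

Definition cl_mk (D : set S) : closed_lower S :=
  ClosedLower (closed_lower_pclosure D).

Definition cl_mul A B : closed_lower S :=
  cl_mk (down [set a * b | a in A & b in B]).

Definition cl_sup (F : set (closed_lower S)) : closed_lower S :=
  cl_mk (\bigcup_(D in F) closed_lower_set D).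

Lemma cl_mulA : associative cl_mul.
Proof.
move=> A B C; apply: val_inj; rewrite /= !pclosure_down.
rewrite -{1}(closed_lowerK A) -{2}(closed_lowerK C) !pclosureM.
congr pclosure; apply/seteqP; split=> [_ [a Aa [_ [b Bb [c Cc <-]] <-]]|].
  by exists (a * b); [exists a => //; exists b | exists c => //; rewrite mulgA].
move=> _ [_ [a Aa [b Bb <-]] [c Cc <-]].
by exists a => //; exists (b * c); [exists b => //; exists c | rewrite mulgA].
Qed.

HB.instance Definition _ := isSemigroup.Build (closed_lower S) cl_mulA.

Lemma closed_lower_le_mulgl A B C : (B <= C)%O -> (A * B <= A * C)%O.
Proof.
rewrite !closed_lower_leE /= !pclosure_down => BC.
by apply: pclosure_mono; exact: image2_subset.
Qed.

Lemma closed_lower_le_mulgr A B C : (B <= C)%O -> (B * A <= C * A)%O.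
Proof.
rewrite !closed_lower_leE /= !pclosure_down => BC.
by apply: pclosure_mono; exact: image2_subset.
Qed.

HB.instance Definition _ := isPoSemigroup.Build set_display (closed_lower S)
  closed_lower_le_mulgl closed_lower_le_mulgr.

Lemma cl_sup_isLub (F : set (closed_lower S)) : isLub F (cl_sup F).
Proof.
split=> [D FD|B ub]; rewrite closed_lower_leE /=.
  by apply: subset_trans (@subset_pclosure _ _ _); exact: bigcup_sup.
rewrite -(closed_lowerK B); apply: pclosure_mono.
by apply: bigcup_sub => D /ub; rewrite closed_lower_leE.
Qed.

Lemma cl_mul_supr A (F : set (closed_lower S)) :
  A * cl_sup F = cl_sup [set A * D | D in F].
Proof.
apply: val_inj; rewrite /= pclosure_down -{1}(closed_lowerK A) pclosureM.
apply/seteqP; split; apply: pclosure_sub.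
  move=> _ [a Aa [b [D FD Db] <-]]; apply: subset_pclosure.
  exists (A * D); first by exists D.
  by rewrite /= pclosure_down; apply: subset_pclosure; exists a => //; exists b.
apply: bigcup_sub => _ [D FD <-]; rewrite /= pclosure_down.
by apply: pclosure_mono => _ [a Aa [b Db <-]]; exists a => //; exists b => //; exists D.
Qed.

Lemma cl_mul_supl (F : set (closed_lower S)) A :
  cl_sup F * A = cl_sup [set D * A | D in F].
Proof.
apply: val_inj; rewrite /= pclosure_down -{1}(closed_lowerK A) pclosureM.
apply/seteqP; split; apply: pclosure_sub.
  move=> _ [b [D FD Db] [a Aa <-]]; apply: subset_pclosure.
  exists (D * A); first by exists D.
  by rewrite /= pclosure_down; apply: subset_pclosure; exists b => //; exists a.
apply: bigcup_sub => _ [D FD <-]; rewrite /= pclosure_down.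
by apply: pclosure_mono => _ [b Db [a Aa <-]]; exists b; [exists D | exists a].
Qed.

HB.instance Definition _ :=
  isQuantale.Build set_display (closed_lower S)
    cl_sup_isLub cl_mul_supr cl_mul_supl.

Lemma is_closed_lower_down (s : S) : is_closed_lower (down [set s]).
Proof. by apply/asboolP; split; [exact: is_lower_down | exact: is_pclosed_down]. Qed.

Definition tau (s : S) : closed_lower S := ClosedLower (is_closed_lower_down s).

End QuantaleOfClosedLowerSets.

Definition closure_preserving d (S : poSemigroupType d)
    d' (T : poSemigroupType d') (f : S -> T) : Prop :=
  forall M : set S, f @` pclosure (down M) `<=` pclosure (down (f @` M)).

Definition posgr_morphism d (S : poSemigroupType d)
    d' (T : poSemigroupType d') (f : S -> T) : Prop :=
  posemigroup_morphism f /\ closure_preserving f.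

(* Main.v *)
(* In a quantale the closure of [D] is [down (qsup D)], so closure preservation
   of a map [f] into a quantale says exactly [f x <= qsup (f @` M)] for every
   [x] in the closure of [M].  Hence [g D = qsup (f @` D)] ignores closures and
   is a quantale morphism; it is the only possible one since
   [D = qsup (tau @` D)] for closed [D].  If [f] is an embedding, a bound
   [b B c <= a] in [S] can be tested after applying [f], which turns
   [f x <= g B] into membership of [x] in the closure of [B]. *)
Require Import Defs.
From mathcomp Require Import all_boot all_order.
From mathcomp Require Import boolp classical_sets.

Set Implicit Arguments.
Unset Strict Implicit.
Unset Printing Implicit Defensive.

Section QuantaleSup.
Import Order.TTheory.
Local Open Scope classical_set_scope.
Local Open Scope group_scope.
Context {d : Order.disp_t} {Q : quantaleType d}.
Implicit Types (A B : set Q) (x y : Q).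

Lemma qsup_ge A x : A x -> (x <= qsup A)%O.
Proof. by have [ubA _] := qsup_isLub A; exact: ubA. Qed.

Lemma qsup_le A y : (forall x, A x -> (x <= y)%O) -> (qsup A <= y)%O.
Proof. by have [_ lubA] := qsup_isLub A; exact: lubA. Qed.

(** Encodes the order as a binary join, which is how join-preserving maps turn out to be
    monotone. *)
Lemma qsup_pair x y : (x <= y)%O -> qsup [set x; y] = y.
Proof.
move=> xy; apply/le_anti/andP; split; last by apply: qsup_ge; right.
by apply: qsup_le => _ [->|->].
Qed.

Lemma mulg_qsup A B : qsup A * qsup B = qsup [set x * y | x in A & y in B].
Proof.
apply/le_anti/andP; split.
  rewrite mulg_qsupl; apply: qsup_le => _ [x Ax <-].
  rewrite mulg_qsupr; apply: qsup_le => _ [y By <-].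
  by apply: qsup_ge; exists x => //; exists y.
apply: qsup_le => _ [x Ax [y By <-]].
apply: (@le_trans _ _ (x * qsup B)); first exact/le_mulgl/qsup_ge.
exact/le_mulgr/qsup_ge.
Qed.

Lemma qsup_bigcup I (F : set I) (G : I -> set Q) :
  qsup (\bigcup_(i in F) G i) = qsup [set qsup (G i) | i in F].
Proof.
apply/le_anti/andP; split; apply: qsup_le.
  move=> x [i Fi Gix]; apply: (le_trans (qsup_ge Gix)).
  by apply: qsup_ge; exists i.
by move=> _ [i Fi <-]; apply: qsup_le => x Gix; apply: qsup_ge; exists i.
Qed.

Lemma act_qsup b c A : ract1 (lact1 b (qsup A)) c =
  qsup [set ract1 (lact1 b x) c | x in A].
Proof.
have -> : lact1 b (qsup A) = qsup [set lact1 b x | x in A].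
  by case: b => [s|] /=; rewrite ?mulg_qsupr ?image_id.
case: c => [s|] //=.
by rewrite mulg_qsupl image_comp.
Qed.

(** Principal lower sets are closed, which gives one inclusion. For the other, two-sided
    translations commute with joins ([act_qsup]), so a bound on every translate of [A] also bounds
    the translate of [qsup A]. *)
Lemma pclosure_quantale A : pclosure A = down [set qsup A].
Proof.
apply/seteqP; split=> x.
  rewrite -(is_pclosed_down (qsup A)); apply: pclosure_mono => y Ay.
  exact/down1E/qsup_ge.
move=> /down1E xA; apply/pclosureE => a b c _ _ Aa.
apply: le_trans (le_act1 b c xA) _; rewrite act_qsup.
by apply: qsup_le => _ [y Ay <-]; exact: Aa.
Qed.

End QuantaleSup.

Section ClosurePreserving.
Import Order.TTheory.
Local Open Scope classical_set_scope.
Local Open Scope group_scope.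
Context {d : Order.disp_t} {S : poSemigroupType d}.
Context {d' : Order.disp_t} {Q : quantaleType d'}.
Implicit Types (f : S -> Q) (M : set S).

Lemma closure_preservingE f : closure_preserving f <->
  forall M x, pclosure M x -> (f x <= qsup (f @` M))%O.
Proof.
split=> [fc M x Mx|fc M].
  apply/down1E; rewrite -pclosure_quantale -pclosure_down; apply: (fc M).
  by exists x; rewrite ?pclosure_down.
rewrite !pclosure_down pclosure_quantale => _ [x Mx <-].
by apply/down1E; exact: fc.
Qed.

Lemma qsup_image_pclosure f M : closure_preserving f ->
  qsup (f @` pclosure M) = qsup (f @` M).
Proof.
move=> /closure_preservingE fc; apply/le_anti/andP; split; apply: qsup_le.
  by move=> _ [x Mx <-]; exact: fc.
move=> _ [x Mx <-]; apply: qsup_ge; exists x => //; exact: subset_pclosure.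
Qed.

End ClosurePreserving.

Section Reflection.
Import Order.TTheory.
Local Open Scope classical_set_scope.
Local Open Scope group_scope.
Context {d : Order.disp_t} {S : poSemigroupType d}.
Implicit Types (A B D : closed_lower S) (s : S).

Lemma pclosure1 s : pclosure [set s] = down [set s].
Proof. by rewrite -pclosure_down is_pclosed_down. Qed.

Lemma tau_le s D : (tau s <= D)%O <-> closed_lower_set D s.
Proof.
rewrite closed_lower_leE; split=> [sD|Ds]; first exact/sD/down1E.
have /asboolP[lD _] := closed_lowerP D.
by move=> x /down1E xs; rewrite -lD; exists s.
Qed.

(** Join-density of the principal lower sets; it makes a quantale morphism on [closed_lower S]
    determined by its composite with [tau]. *)
Lemma qsup_tau D : qsup (tau @` D) = D.
Proof.
apply/le_anti/andP; split.
  by apply: qsup_le => _ [s Ds <-]; apply/tau_le.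
rewrite closed_lower_leE => s Ds; apply/tau_le.
by apply: qsup_ge; exists s.
Qed.

Lemma tauM s t : tau (s * t) = tau s * tau t.
Proof.
(* Principal lower sets are read as closures of singletons, so that [pclosureM] reduces the claim to
   a product of singletons. *)
apply: val_inj; rewrite /= pclosure_down -!pclosure1 pclosureM.
congr pclosure; apply/seteqP; split=> [_ ->|_ [_ -> [_ -> <-]] //].
by exists s => //; exists t.
Qed.

Lemma tau_posgr : posgr_morphism (tau : S -> closed_lower S).
Proof.
split; first split; last 1 first.
- apply/closure_preservingE => M x Mx; apply/tau_le.
  apply: pclosure_mono Mx => y My; exists (tau y); first by exists y.
  exact/down1E.
- by move=> s t st; apply/tau_le/down1E.
- exact: tauM.
Qed.

Context {d' : Order.disp_t} {Q : quantaleType d'}.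

Lemma quantale_morphism_homo d1 (P : quantaleType d1) (g : P -> Q) :
  quantale_morphism g -> {homo g : x y / (x <= y)%O}.
Proof.
move=> [_ gsup] x y xy; rewrite -(qsup_pair xy) gsup.
by apply: qsup_ge; exists x => //; left.
Qed.

Lemma posgr_quantale_morphism d1 (P : quantaleType d1) (h : P -> Q) :
  posgr_morphism h <-> quantale_morphism h.
Proof.
split=> [[[hh hM] /closure_preservingE hc]|hq].
  split=> // A; apply/le_anti/andP; split.
    (* Closure preservation is used at the point [qsup A], which lies in the closure of [A]. *)
    by apply: hc; rewrite pclosure_quantale; apply/down1E.
  by apply: qsup_le => _ [x Ax <-]; apply/hh/qsup_ge.
have hh := quantale_morphism_homo hq; case: (hq) => hM hsup.
split=> //; apply/closure_preservingE => M x.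
by rewrite pclosure_quantale -hsup => /down1E; exact: hh.
Qed.

(** Products and joins of closed lower sets are closures of elementwise products and of unions; once
    the closures are dropped, distributivity in [Q] and associativity of joins remain. *)
Lemma quantale_morphism_qsup_image (f : S -> Q) : posgr_morphism f ->
  quantale_morphism (fun D : closed_lower S => qsup (f @` D)).
Proof.
move=> [[_ fM] fc]; split=> [A B|F] /=.
  rewrite pclosure_down qsup_image_pclosure // mulg_qsup; congr qsup.
  apply/seteqP; split.
    move=> _ [_ [a Aa [b Bb <-]] <-]; exists (f a); first by exists a.
    by exists (f b); [exists b | rewrite fM].
  move=> _ [_ [a Aa <-] [_ [b Bb <-] <-]]; exists (a * b) => //.
  by exists a => //; exists b.
by rewrite qsup_image_pclosure // image_bigcup qsup_bigcup.
Qed.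

Lemma qsup_image_tau (f : S -> Q) s : {homo f : x y / (x <= y)%O} ->
  qsup (f @` tau s) = f s.
Proof.
move=> fh; apply/le_anti/andP; split.
  by apply: qsup_le => _ [x /down1E xs <-]; exact: fh.
by apply: qsup_ge; exists s => //; apply/down1E.
Qed.

Lemma quantale_morphismE (g : closed_lower S -> Q) D :
  quantale_morphism g -> g D = qsup ((g \o tau) @` D).
Proof. by move=> [_ gsup]; rewrite -{1}(qsup_tau D) gsup image_comp. Qed.

(** [omap f] keeps [None], which acts trivially on [Q] as well, so translations are transported
    along [f] even if [Q] has an identity of its own. *)
Lemma act_morph (f : S -> Q) b c x : {morph f : x y / x * y} ->
  f (ract1 (lact1 b x) c) = ract1 (lact1 (omap f b) (f x)) (omap f c).
Proof. by move=> fM; case: b c => [s|] [t|] //=; rewrite !fM. Qed.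

Lemma order_embedding_pclosure (f : S -> Q) (M : set S) x :
  {morph f : x y / x * y} -> order_embedding f ->
  (f x <= qsup (f @` M))%O -> pclosure M x.
Proof.
move=> fM fe fx; apply/pclosureE => a b c _ _ Ma.
rewrite -fe act_morph //; apply: le_trans (le_act1 _ _ fx) _.
rewrite act_qsup; apply: qsup_le => _ [_ [y My <-] <-].
by rewrite -act_morph // fe; exact: Ma.
Qed.

End Reflection.

Theorem theorem4p12 (d : Order.disp_t) (S : poSemigroupType d) :
  [/\ posgr_morphism (tau : S -> closed_lower S),
      forall (d' : Order.disp_t) (Q : quantaleType d') (f : S -> Q),
        posgr_morphism f ->
        exists! g : closed_lower S -> Q, quantale_morphism g /\ g \o tau = f,
      forall (d1 d2 : Order.disp_t) (P : quantaleType d1) (Q : quantaleType d2)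
          (h : P -> Q),
        posgr_morphism h <-> quantale_morphism h
    & forall (d' : Order.disp_t) (Q : quantaleType d') (f : S -> Q),
        posgr_morphism f -> order_embedding f ->
        forall g : closed_lower S -> Q,
          quantale_morphism g -> g \o tau = f -> order_embedding g].
Proof.
split.
- exact: tau_posgr.
- move=> d' Q f fp; exists (fun D => qsup (image D f)); split.
    split; first exact: quantale_morphism_qsup_image.
    by apply: funext => s /=; apply: qsup_image_tau; case: fp => -[].
  move=> g [gq gf]; apply: funext => D.
  by rewrite (quantale_morphismE D gq) gf.
- by move=> d1 d2 P Q h; exact: posgr_quantale_morphism.
- move=> d' Q f [[_ fM] _] fe g gq gf A B.
  apply/idP/idP; last exact: quantale_morphism_homo.
  move=> gAB; rewrite closed_lower_leE => x Ax; rewrite -(closed_lowerK B).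
  apply: (order_embedding_pclosure fM fe).
  (* The bound required is [g (tau x) <= g B]; it passes through [g A], since [tau x <= A]. *)
  rewrite -gf -quantale_morphismE //; apply: Order.POrderTheory.le_trans gAB.
  by apply: quantale_morphism_homo => //; apply/tau_le.
Qed.
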